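(* Let $\varepsilon>0$. For every sufficiently large $n$ there is a standard set $A\subset\mathbb Z_2^n$ such that \[ \lambda(A)<\varepsilon\quad\text{and}\quad \lambda^\pm(A)>\tfrac12-\varepsilon. \]
   Context: For a finite commutative group $G$ (written additively), a set $A\subset G$ is a standard set if $A=-A$ and $0\in A$. A character of $G$ is a homomorphism $\gamma:G\to\{z\in\mathbb C:|z|=1\}$; $\hat G$ is the group of characters and $\mathbf 1$ the principal character. For $f:G\to\mathbb R$, $\hat f(\gamma)=\sum_{x\in G}\gamma(x)f(x)$. For a standard set $A$, let $\mathcal S(A)$ be the set of functions $f:G\to\mathbb R$, not identically zero, with $f=0$ on $G\setminus A$, and $\mathcal S^\pm(A)$ the set of functions $f:G\to\mathbb R$, not identically zero, with $f\le 0$ on $G\setminus A$ and $f\ge 0$ on $A$. Then $\lambda(A)=\min\{f(0)/\hat f(\mathbf 1): f\in\mathcal S(A),\ \hat f(\gamma)\ge 0\ \forall\gamma\in\hat G\}$ and $\lambda^\pm(A)$ is defined the same way with $\mathcal S^\pm(A)$ in place of $\mathcal S(A)$. *)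

(* Defs.v *)
From HB Require Import structures.
From mathcomp Require Export all_boot all_order all_algebra.
From mathcomp Require Export complex.
From mathcomp Require Export boolp classical_sets reals.

Set Implicit Arguments.
Unset Strict Implicit.
Unset Printing Implicit Defensive.

Import Order.TTheory GRing.Theory Num.Theory.

Local Open Scope ring_scope.
Local Open Scope complex_scope.

Section Turan.
Variables (R : realType) (G : finZmodType).
Implicit Types (A : {set G}) (f : G -> R) (gamma : G -> R[i]).

Definition standard A : Prop :=
  A = [set - x | x in A]%SET /\ 0 \in A.

Definition character gamma : Prop :=
  (forall x y, gamma (x + y) = gamma x * gamma y) /\
  (forall x, `|gamma x| = 1).

Definition principal : G -> R[i] := fun=> 1.

Definition fourier f gamma : R[i] := \sum_(x : G) gamma x * (f x)%:C.

(* The order on R[i] is partial: 0 <= z means that z is real and nonnegative. *)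
Definition fourier_nonneg f : Prop :=
  forall gamma, character gamma -> 0 <= fourier f gamma.

Definition classS A f : Prop :=
  (exists x, f x != 0) /\ (forall x, x \notin A -> f x = 0).

Definition classSpm A f : Prop :=
  [/\ exists x, f x != 0,
      forall x, x \notin A -> f x <= 0 &
      forall x, x \in A -> 0 <= f x].

(* Division by zero yields 0 in the library, so the functions whose transform
   vanishes at the principal character (where the quotient is +oo, as f 0 > 0
   for every admissible f) have to be excluded explicitly. *)
Definition ratios (S : (G -> R) -> Prop) : set R :=
  [set r | exists f, [/\ S f, fourier_nonneg f, fourier f principal != 0 &
                         r%:C = (f 0)%:C / fourier f principal]]%classic.

Definition is_minimum (E : set R) (m : R) : Prop :=
  E m /\ (forall r, E r -> m <= r).

(* Relational, so that asserting [is_lambda A l] includes the existence of the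
   minimum; l is then unique. *)
Definition is_lambda A (l : R) : Prop := is_minimum (ratios (classS A)) l.

Definition is_lambda_pm A (l : R) : Prop := is_minimum (ratios (classSpm A)) l.

End Turan.

(* Main.v *)
(* Let |x| be the Hamming weight. The set A consists of 0 and of the vectors of
   weight at least n - d, where d is a small multiple of n.

   Test a function f of the class S^pm(A) against x |-> 2 n - 2 d - 2 |x|, which
   has nonnegative Fourier coefficients and mean n - 2 d, is nonpositive on A
   away from 0 and nonnegative off A. This gives
   (n - 2 d) hat f(1) <= (2 n - 2 d) f(0), so lambda^pm(A) >= 1/2 - d/n.

   For lambda(A), multiplying hat f(gamma) by the sum of the gamma(e_i)
   corresponds to f |-> sum_i f(. + e_i). Hence a polynomial of degree d in this
   sum, multiplied by gamma(1,...,1), is the transform of a function supported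
   on the weights >= n - d. Take the Chebyshev polynomial T_d, rescaled so that
   its argument lies in [-1, 1] for every nonprincipal gamma and is 1 + 2/n for
   the principal one. Adding the point mass at 0 makes the transform
   nonnegative, and its principal value is 1 + T_d(1 + 2/n) >= 2 + 2 d^2 / n.

   The minima exist by compactness: after normalising f(0) = 1, Fourier
   inversion gives |f| <= 1. *)

Require Import Defs.
From mathcomp Require Import all_boot all_order all_algebra.
From mathcomp Require Import reals.
From mathcomp Require Import topology normedtype derive ring lra zify.

Set Implicit Arguments.
Unset Strict Implicit.
Unset Printing Implicit Defensive.

Import Order.TTheory GRing.Theory Num.Theory.
Import numFieldNormedType.Exports.

Local Open Scope ring_scope.

(** * Attainment of linear programs over products of compact sets *)

Definition pairing (R : realType) (G : finType) (g f : G -> R) : R :=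
  \sum_x g x * f x.

Lemma pairing_point (R : realType) (G : finType) (g : G -> R) (y : G) :
  pairing g (fun x => (x == y)%:R) = g y.
Proof.
rewrite /pairing (bigD1 y) //= eqxx mulr1 big1 ?addr0 // => x /negPf->.
by rewrite mulr0.
Qed.

Lemma pairing_continuous (R : realType) (G : finType) (c : G -> R) :
  continuous (fun f : prod_topology (fun _ : G => R : topologicalType) =>
    pairing c f).
Proof.
set T := prod_topology _.
have eval_continuous x : continuous (fun f : T => f x).
  by move=> f; exact: (@proj_continuous G (fun=> R) x f).
have term_continuous x : continuous (fun f : T => c x * f x).
  move=> f; exact: (cvg_comp (fun f : T => f x) ( *%R (c x))
    (eval_continuous x f) (@mulrl_continuous R (c x) (f x))).
by have := @continuous_big R G +%R 0 xpredT (@add_continuous R) T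
  (index_enum G) (fun x f => c x * f x) (fun x _ => term_continuous x); apply.
Qed.

(** The feasible set is compact: Tychonoff handles the product, and each constraint is closed
    because [pairing] is a finite sum. The point [f1] makes it nonempty. *)
Lemma linear_program_attained (R : realType) (G : finType) (K : G -> set R)
    (L : set (G -> R)) (c f1 : G -> R) :
  (forall x, compact (K x)) ->
  (forall x, K x (f1 x)) -> (forall g, L g -> 0 <= pairing g f1) ->
  exists f0, [/\ forall x, K x (f0 x), forall g, L g -> 0 <= pairing g f0 &
    forall f, (forall x, K x (f x)) -> (forall g, L g -> 0 <= pairing g f) ->
      pairing c f <= pairing c f0].
Proof.
move=> cK Kf1 Lf1.
pose T := prod_topology (fun _ : G => R : topologicalType).
pose P : set T := ([set f : T | forall x, K x (f x)] `&`
  \bigcap_(g in L) [set f : T | 0 <= pairing g f])%classic.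
have cP : compact P.
  apply: compact_closedI; first exact: tychonoff.
  apply: closed_bigI => g Lg.
  apply: (@preimage_closed T R (pairing g) [set y | 0 <= y]%classic).
    by move=> f _; exact: pairing_continuous.
  exact: closed_ge.
have P0 : (P !=set0)%classic by exists f1; split.
have cc : {within P, continuous (pairing c : T -> R)}%classic.
  by apply: continuous_subspaceT; exact: pairing_continuous.
have [f0 /set_mem[Kf0 Lf0] f0max] := compact_EVT_max P0 cP cc.
exists f0; split => // f Kf Lf; apply: f0max.
by apply/mem_set; split.
Qed.

(** * Real characters, and groups in which every [x + x] vanishes *)

Definition real_character (R : realType) (G : finZmodType) (g : G -> R) :=
  (forall x y, g (x + y) = g x * g y) /\ (forall x, `|g x| = 1).

Section RealCharacters.
Variables (R : realType) (G : finZmodType).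
Implicit Types (f g : G -> R).
Local Open Scope complex_scope.

Lemma real_character0 g : real_character g -> g 0 = 1.
Proof.
move=> [gM g1]; have g0 : g 0 != 0 by rewrite -normr_eq0 g1 oner_eq0.
by apply: (mulfI g0); rewrite -gM addr0 mulr1.
Qed.

Lemma normc_real (a : R) : `|a%:C| = `|a|%:C.
Proof. by rewrite normc_def /= expr0n addr0 sqrtr_sqr. Qed.

Lemma real_character_complex g :
  real_character g -> character (fun x => (g x)%:C).
Proof.
move=> [gM g1]; split=> [x y|x]; first by rewrite gM rmorphM.
by rewrite normc_real g1.
Qed.

Lemma fourier_real f g : fourier f (fun x => (g x)%:C) = (pairing g f)%:C.
Proof.
by rewrite /fourier rmorph_sum; apply: eq_bigr => x _; rewrite rmorphM.
Qed.

Lemma fourier_principal f : fourier f (@principal R G) = (\sum_x f x)%:C.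
Proof.
by rewrite /fourier rmorph_sum; apply: eq_bigr => x _; rewrite mul1r.
Qed.

Lemma real_character1 : real_character (fun _ : G => 1 : R).
Proof. by split=> [x y|x]; rewrite ?mulr1 ?normr1. Qed.

Lemma pairing1 f : pairing (fun=> 1) f = \sum_x f x.
Proof. by apply: eq_bigr => x _; rewrite mul1r. Qed.

Hypothesis addxx : forall x : G, x + x = 0.

(** Each value squares to [gamma (x + x) = gamma 0 = 1], hence is 1 or -1. *)
Lemma character_real gamma : @character R G gamma ->
  exists2 g, real_character g & gamma = (fun x => (g x)%:C).
Proof.
move=> [gM g1].
have g0 : gamma 0 = 1.
  have n0 : gamma 0 != 0 by rewrite -normr_eq0 g1 oner_eq0.
  by apply: (mulfI n0); rewrite -gM addr0 mulr1.
have gE x : gamma x = (complex.Re (gamma x))%:C.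
  have /eqP : gamma x ^+ 2 = 1 by rewrite expr2 -gM addxx.
  by rewrite sqrf_eq1 => /orP[] /eqP->; rewrite ?raddfN.
exists (fun x => complex.Re (gamma x)); last by apply/funext.
split=> [x y|x].
  by apply: complexI; rewrite rmorphM /= -!gE gM.
by apply: complexI; rewrite -normc_real -gE g1.
Qed.

Lemma fourier_nonnegP f : fourier_nonneg f <->
  (forall g, real_character g -> 0 <= pairing g f).
Proof.
split=> [fp g /real_character_complex/fp|fp gamma /character_real[g gP ->]].
  by rewrite fourier_real lecR.
by rewrite fourier_real lecR fp.
Qed.

(** Moves the ratios from complex to real numbers. The principal coefficient is [\sum_x f x], which
    is already nonnegative, so nonvanishing becomes positivity. *)
Lemma ratiosP (S : (G -> R) -> Prop) r : ratios S r <->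
  exists f, [/\ S f, forall g, real_character g -> 0 <= pairing g f,
                0 < \sum_x f x & r = f 0 / \sum_x f x].
Proof.
split=> -[f]; rewrite ?fourier_principal.
  move=> [Sf /fourier_nonnegP fp f1 /eqP rE]; exists f; split => //.
    rewrite lt_def -{2}pairing1 fp ?andbT; last exact: real_character1.
    by apply: contraNneq f1 => ->.
  by apply: complexI; rewrite (eqP rE) fmorph_div.
move=> [Sf fp f1 ->]; exists f; rewrite fourier_principal; split => //.
- exact/fourier_nonnegP.
- by rewrite fmorph_eq0 gt_eqF.
- by rewrite fmorph_div.
Qed.

End RealCharacters.

(** * Fourier inversion on the cube and existence of the minima *)

Section Cube.
Variables (R : realType) (n : nat).
Local Notation G := 'rV['Z_2]_n.
Implicit Types (f g : G -> R) (x y : G).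

Definition sign2 (a : 'Z_2) : R := (-1) ^+ (a : nat).

Lemma sign2D a b : sign2 (a + b) = sign2 a * sign2 b.
Proof.
by case: a => -[|[|//]] ?; case: b => -[|[|//]] ?;
  rewrite /sign2 /= ?mulr1 ?mul1r // mulrNN mulr1.
Qed.

Lemma sign2_cases a : sign2 a = 1 \/ sign2 a = -1.
Proof. by case: a => -[|[|//]] ?; [left|right]. Qed.

Lemma norm_sign2 a : `|sign2 a| = 1.
Proof. by case: (sign2_cases a) => ->; rewrite ?normrN1 ?normr1. Qed.

Lemma Z2_neq0 (a : 'Z_2) : a != 0 -> a = 1.
Proof. by case: a => -[|[|//]] // ? _; apply/val_inj. Qed.

Lemma cube_addxx x : x + x = 0.
Proof.
apply/rowP => i; rewrite !mxE.
by case: (x 0 i) => -[|[|//]] ?; apply/val_inj.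
Qed.

Lemma cube_oppr x : - x = x.
Proof. by apply/eqP; rewrite eq_sym -addr_eq0 cube_addxx. Qed.

Definition chi y x : R := sign2 ((x *m y^T) 0 0).

Lemma chi_real_character y : real_character (chi y).
Proof.
split=> [x z|x]; last exact: norm_sign2.
by rewrite /chi mulmxDl mxE sign2D.
Qed.

Lemma chiC y x : chi y x = chi x y.
Proof.
rewrite /chi (_ : y *m x^T = (x *m y^T)^T); last by rewrite trmx_mul trmxK.
by rewrite [in RHS]mxE.
Qed.

(** If some coordinate of [x] is nonzero, translating [y] by the corresponding unit vector negates
    the sum. *)
Lemma chi_orthogonality x : \sum_y chi y x = (x == 0)%:R *+ #|{: G}|.
Proof.
have [->|x0] := eqVneq x 0.
  rewrite mulr1n -sumr_const; apply: eq_bigr => y _.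
  by rewrite (real_character0 (chi_real_character y)).
rewrite mul0rn; have [i xi] : exists i, x 0 i != 0.
  apply/existsP; apply: contraNT x0; rewrite negb_exists => /forallP x0.
  by apply/eqP/rowP => i; rewrite mxE; exact/eqP/negPn/x0.
have flip : chi (delta_mx 0 i) x = -1.
  by rewrite /chi trmx_delta -colE mxE (Z2_neq0 xi).
have SN : \sum_y chi y x = - \sum_y chi y x.
  rewrite [LHS](reindex_inj (addrI (delta_mx 0 i))) /= -sumrN.
  apply: eq_bigr => y _.
  by rewrite chiC (chi_real_character x).1 [chi x _]chiC flip mulN1r chiC.
by apply/eqP; move/eqP: SN; rewrite -addr_eq0 -mulr2n mulrn_eq0.
Qed.

Lemma fourier_inversion f x :
  f x *+ #|{: G}| = \sum_y chi y x * pairing (chi y) f.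
Proof.
under [RHS]eq_bigr do rewrite mulr_sumr.
rewrite exchange_big /= (bigD1 x) //= [X in _ + X]big1 ?addr0.
  under eq_bigr do rewrite mulrA -(chi_real_character _).1 cube_addxx.
  by rewrite -mulr_suml chi_orthogonality eqxx mulrnAl mul1r.
move=> z zx; under eq_bigr do rewrite mulrA -(chi_real_character _).1.
rewrite -mulr_suml chi_orthogonality addr_eq0 cube_oppr eq_sym (negPf zx).
by rewrite mul0rn mul0r.
Qed.

(** With nonnegative coefficients, the absolute values of the terms of the inversion sum at [x] are
    exactly its terms at 0. *)
Lemma positive_definite_bound f x :
  (forall g, real_character g -> 0 <= pairing g f) -> `|f x| <= f 0.
Proof.
move=> fp; have G0 : (0 < #|{: G}|)%N by apply/card_gt0P; exists 0.
rewrite -(ler_pMn2r G0) -normrMn !fourier_inversion.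
apply: le_trans (ler_norm_sum _ _ _) _; apply: ler_sum => y _.
have fy := fp _ (chi_real_character y).
rewrite normrM (chi_real_character y).2 ger0_norm //.
by rewrite (real_character0 (chi_real_character y)).
Qed.

(** Both classes are given by sign constraints on two sets [P] and [N], so one statement serves for
    both. Minimising the ratio amounts to maximising [\sum_x f x] under [f 0 = 1]. *)
Lemma ratios_minimum (P N : {set G}) (S : (G -> R) -> Prop) :
  0 \notin N ->
  (forall f, S f <-> [/\ exists x, f x != 0, forall x, x \in P -> 0 <= f x
                      & forall x, x \in N -> f x <= 0]) ->
  exists l, is_minimum (ratios S) l.
Proof.
move=> N0 SE.
(* Each boolean cast gives the endpoint 0 where a sign is imposed, and otherwise the bound -1 or 1
   that positive definiteness provides. *)
pose K x : set R := (if x == 0 then `[1, 1]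
  else `[- (x \notin P)%:R, (x \notin N)%:R])%classic.
pose f1 x : R := (x == 0)%:R.
have Kf1 x : K x (f1 x).
  rewrite /K /f1; case: eqP => _ /=; rewrite in_itv /= ?lexx //.
  by rewrite oppr_le0 !ler0n.
have f1p (g : G -> R) : real_character g -> 0 <= pairing g f1.
  by move=> gP; rewrite pairing_point (real_character0 gP).
have cK x : compact (K x).
  by rewrite /K; case: ifP => _; exact: segment_compact.
have [f0 [Kf0 f0p f0max]] := linear_program_attained (fun=> 1) cK Kf1 f1p.
have f00 : f0 0 = 1.
  by apply/eqP; have := Kf0 0; rewrite /K eqxx /= in_itv /= eq_le andbC.
have M1 : 1 <= \sum_x f0 x.
  by have := f0max f1 Kf1 f1p; rewrite pairing_point pairing1.
have M0 := lt_le_trans ltr01 M1.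
exists (\sum_x f0 x)^-1; split.
  apply/(ratiosP cube_addxx); exists f0; split => //; last by rewrite f00 mul1r.
  apply/SE; split; first by exists 0; rewrite f00 oner_eq0.
    move=> x xP; have := Kf0 x; rewrite /K; case: eqP => [->|_] /=.
      by rewrite f00.
    by rewrite in_itv /= xP oppr0 => /andP[].
  move=> x xN; have := Kf0 x; rewrite /K; case: eqP => [x0|_] /=.
    by rewrite -x0 xN in N0.
  by rewrite in_itv /= xN => /andP[].
move=> r /(ratiosP cube_addxx)[f [/SE[[z fz] fP fN] fp sf ->]].
have f0gt : 0 < f 0.
  by apply: lt_le_trans (positive_definite_bound z fp); rewrite normr_gt0.
(* After inverting both ratios, the claim is the maximality of [f0] against the competitor
   [f / f 0]. *)
rewrite -[leRHS]invf_div lef_pV2 ?posrE ?divr_gt0 //.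
rewrite mulr_suml -!pairing1; apply: f0max => [x|g gP].
  have := positive_definite_bound x fp; rewrite ler_norml => /andP[fl fu].
  rewrite /K; case: eqP => [->|_] /=; rewrite in_itv /= ?divff ?lexx ?gt_eqF //.
  rewrite ler_pdivlMr // ler_pdivrMr //.
  have /orP[xP|xP] := orbN (x \in P); have /orP[xN|xN] := orbN (x \in N);
    rewrite ?xP ?xN ?(negPf xP) ?(negPf xN) /=;
    by rewrite ?oppr0 ?mul0r ?mulN1r ?mul1r ?fl ?fu ?fP ?fN.
rewrite (_ : pairing _ _ = pairing g f / f 0) ?divr_ge0 ?fp ?(ltW f0gt) //.
by rewrite mulr_suml; apply: eq_bigr => x _; rewrite mulrA.
Qed.

End Cube.

(** * Chebyshev polynomials of the first kind *)

Section Chebyshev.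
Variable R : realType.
Implicit Types z t : R.

Fixpoint chebyshev z k : R :=
  if k is k1.+1 then
    if k1 is k2.+1 then 2 * z * chebyshev z k1 - chebyshev z k2 else z
  else 1.

Lemma chebyshevSS z k :
  chebyshev z k.+2 = 2 * z * chebyshev z k.+1 - chebyshev z k.
Proof. by []. Qed.

(* [u] is the value at [z] of the Chebyshev polynomial [U_(k-1)] of the second
   kind. *)
Lemma chebyshev_pell z k : exists u,
  chebyshev z k ^+ 2 + (1 - z ^+ 2) * u ^+ 2 = 1 /\
  chebyshev z k.+1 = z * chebyshev z k - (1 - z ^+ 2) * u.
Proof.
elim: k => [|k [u [pell TS]]]; first by exists 0; split => /=; ring.
(* This is the recurrence [U_k = T_k + z U_(k-1)]. *)
exists (chebyshev z k + z * u); rewrite chebyshevSS TS.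
by split; [rewrite -[RHS]pell|]; ring.
Qed.

(** For [|z| <= 1] the Pell identity writes 1 as [T_k ^ 2] plus a nonnegative term. *)
Lemma chebyshev_le1 z k : `|z| <= 1 -> `|chebyshev z k| <= 1.
Proof.
move=> z1; have [u [pell _]] := chebyshev_pell z k.
rewrite -(@ler_sqr _ `|_|) ?nnegrE // real_normK ?num_real // expr1n -pell.
rewrite lerDl mulr_ge0 ?sqr_ge0 // subr_ge0.
by rewrite -real_normK ?num_real // expr_le1.
Qed.

(** The induction also carries a bound on the increments: each exceeds the previous one by
    [2 t T_(k+1) >= 2 t], and the first [k] odd numbers sum to [k ^ 2]. *)
Lemma chebyshev_growth t k : 0 <= t ->
  1 + k%:R ^+ 2 * t <= chebyshev (1 + t) k.
Proof.
move=> t0.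
suff : 1 + k%:R ^+ 2 * t <= chebyshev (1 + t) k /\
    (2 * k%:R + 1) * t <= chebyshev (1 + t) k.+1 - chebyshev (1 + t) k by case.
elim: k => [|k [IHT IHD]]; first by split => /=; lra.
have T1 : 1 + k.+1%:R ^+ 2 * t <= chebyshev (1 + t) k.+1.
  by rewrite -natr1; lra.
split => //; rewrite chebyshevSS -natr1.
have : 0 <= t * (chebyshev (1 + t) k.+1 - 1).
  rewrite mulr_ge0 // subr_ge0 (le_trans _ T1) // lerDl mulr_ge0 //.
  exact: sqr_ge0.
by lra.
Qed.

End Chebyshev.

(** * Chebyshev kernels on the cube: transform and support *)

Section Construction.
Variables (R : realType) (n : nat).
Local Notation G := 'rV['Z_2]_n.
Implicit Types (f g : G -> R) (x y : G) (i : 'I_n).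

Definition unitv i : G := delta_mx 0 i.

(* [bias x = n - 2 |x|], where [|x|] is the Hamming weight. *)
Definition bias x : R := \sum_i sign2 R (x 0 i).

Definition smooth f x : R := n%:R^-1 * (\sum_i f (x + unitv i) + 2 * f x).

(** The Chebyshev recurrence with multiplication by [z] replaced by the operator [smooth], applied
    to the point mass at the all-ones vector. *)
Fixpoint chebyshev_kernel k : G -> R :=
  if k is k1.+1 then
    if k1 is k2.+1 then
      fun x => 2 * smooth (chebyshev_kernel k1) x - chebyshev_kernel k2 x
    else smooth (fun x => (x == const_mx 1)%:R)
  else fun x => (x == const_mx 1)%:R.

(* The affine map sends [n], the value of the character sum at the principal
   character, to [1 + 2 / n], and its other values, which lie in [-n, n - 2],
   into [-1, 1]. *)
Definition multiplier g : R := n%:R^-1 * (\sum_i g (unitv i) + 2).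

(** Translation by [unitv i] is an involution, so reindexing moves it from [f] to [g], where it
    becomes the factor [g (unitv i)]. *)
Lemma pairing_smooth g f : real_character g ->
  pairing g (smooth f) = multiplier g * pairing g f.
Proof.
move=> [gM _].
have shift i : \sum_x g x * f (x + unitv i) = g (unitv i) * pairing g f.
  rewrite (reindex_inj (addIr (unitv i))) /= mulr_sumr; apply: eq_bigr => x _.
  by rewrite -addrA cube_addxx addr0 gM mulrCA mulrA.
rewrite /pairing /multiplier -mulrA mulrDl mulr_suml.
under [in RHS]eq_bigr do rewrite -shift.
rewrite exchange_big /= mulr_sumr -big_split mulr_sumr /=.
apply: eq_bigr => x _; rewrite /smooth -mulr_sumr; ring.
Qed.

Lemma pairing_chebyshev_kernel g k : real_character g ->
  pairing g (chebyshev_kernel k) =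
  g (const_mx 1) * chebyshev (multiplier g) k.
Proof.
move=> gP.
suff : pairing g (chebyshev_kernel k) =
     g (const_mx 1) * chebyshev (multiplier g) k
  /\ pairing g (chebyshev_kernel k.+1) =
     g (const_mx 1) * chebyshev (multiplier g) k.+1 by case.
elim: k => [|k [IH0 IH1]].
  split; rewrite [chebyshev_kernel _]/= ?pairing_smooth // pairing_point.
    by rewrite mulr1.
  by rewrite mulrC.
split => //; rewrite chebyshevSS mulrBr -IH0 mulrCA -IH1 -mulrA.
rewrite -pairing_smooth //.
by rewrite /pairing mulr_sumr -sumrB; apply: eq_bigr => x _ /=; ring.
Qed.

Lemma bias_shift x i : bias x <= bias (x + unitv i) + 2.
Proof.
rewrite /bias (bigD1 i) //= [in leRHS](bigD1 i) //=.
rewrite [X in _ <= _ + X + _](eq_bigr (fun j => sign2 R (x 0 j))); last first.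
  by move=> j ji; rewrite !mxE (negPf ji) addr0.
have [] := sign2_cases R (x 0 i); have [] := sign2_cases R ((x + unitv i) 0 i).
all: by move=> -> ->; lra.
Qed.

Lemma bias0 : bias 0 = n%:R.
Proof.
by rewrite /bias; under eq_bigr do rewrite mxE; rewrite sumr_const card_ord.
Qed.

Lemma bias_ones : bias (const_mx 1) = - n%:R.
Proof.
rewrite /bias; under eq_bigr do rewrite mxE.
by rewrite sumr_const card_ord /sign2 /= expr1 mulNrn.
Qed.

Lemma smooth_support f (a : R) x :
  (forall y, f y != 0 -> bias y <= a) -> smooth f x != 0 -> bias x <= a + 2.
Proof.
move=> fa; apply: contraNT; rewrite -ltNge => ax; rewrite /smooth.
rewrite big1 ?add0r => [|i _]; last first.
  have := bias_shift x i; apply: contraTeq => /fa; lra.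
suff /eqP-> : f x == 0 by rewrite !mulr0.
by apply: contraTT ax => /fa; rewrite -leNgt; lra.
Qed.

(** The all-ones vector has bias [- n], and each use of [smooth] raises the bias on the support by
    at most 2. *)
Lemma chebyshev_kernel_support k x :
  chebyshev_kernel k x != 0 -> bias x <= 2 * k%:R - n%:R.
Proof.
have base y : chebyshev_kernel 0 y != 0 -> bias y <= - n%:R.
  by rewrite /= pnatr_eq0 eqb0 negbK => /eqP->; rewrite bias_ones.
move: x; suff : (forall x, chebyshev_kernel k x != 0 ->
                   bias x <= 2 * k%:R - n%:R) /\
                (forall x, chebyshev_kernel k.+1 x != 0 ->
                   bias x <= 2 * k.+1%:R - n%:R) by case.
elim: k => [|k [IH0 IH1]].
  split => x; first by move/base; lra.
  by move/(smooth_support base); lra.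
split => // x nz.
have [s0|] := eqVneq (smooth (chebyshev_kernel k.+1) x) 0; last first.
  by move/(smooth_support IH1); rewrite -[k.+2%:R]natr1; lra.
have : chebyshev_kernel k x != 0.
  by move: nz; rewrite /= -/(chebyshev_kernel k.+1) s0 mulr0 add0r oppr_eq0.
by move/IH0; rewrite -[k.+2%:R]natr1 -natr1; lra.
Qed.

Lemma const_mx1E : const_mx 1 = \sum_i unitv i.
Proof.
apply/rowP => j; rewrite summxE (bigD1 j) //= big1 ?addr0 => [|i ij].
  by rewrite !mxE !eqxx.
by rewrite mxE eq_sym (negPf ij) andbF.
Qed.

Lemma real_character_ones g : real_character g ->
  (forall i, g (unitv i) = 1) -> g (const_mx 1) = 1.
Proof.
move=> gP g1; rewrite const_mx1E (big_morph g gP.1 (real_character0 gP)).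
by apply: big1 => i _; exact: g1.
Qed.

Lemma real_character_pm1 g x : real_character g -> g x != 1 -> g x = -1.
Proof.
move=> [_ /(_ x)/eqP]; rewrite eqr_norml ler01 andbT.
by case/predU1P=> [->|/eqP//]; rewrite eqxx.
Qed.

(** A single value -1 keeps the character sum at most [n - 2], which the added 2 brings to [n]; the
    lower bound only uses that each value is at least -1. *)
Lemma multiplier_le1 g i : real_character g -> g (unitv i) != 1 ->
  `|multiplier g| <= 1.
Proof.
move=> gP gi.
have n0 : 0 < n%:R :> R by rewrite ltr0n (leq_ltn_trans _ (ltn_ord i)).
have glb j : -1 <= g (unitv j) <= 1 by rewrite -ler_norml gP.2.
rewrite /multiplier normrM normfV (gtr0_norm n0) ler_pdivrMl // mulr1 ler_norml.
apply/andP; split.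
  apply: (@le_trans _ _ (\sum_(j < n) -1)).
    by rewrite sumr_const card_ord mulNrn.
  apply: (@le_trans _ _ (\sum_j g (unitv j))); last by rewrite lerDl.
  by apply: ler_sum => j _; case/andP: (glb j).
rewrite (bigD1 i) //= (real_character_pm1 gP gi).
have -> : n%:R = 1 + \sum_(j < n | j != i) 1 :> R.
  by rewrite -{1}[n]card_ord -sumr_const (bigD1 i).
have : \sum_(j < n | j != i) g (unitv j) <= \sum_(j < n | j != i) 1.
  by apply: ler_sum => j _; case/andP: (glb j).
by lra.
Qed.

(** * The witness that bounds [lambda] from above *)

Definition turan_witness d x : R := (x == 0)%:R + chebyshev_kernel d x.

Lemma pairing_turan_witness g d : real_character g ->
  pairing g (turan_witness d) =
  1 + g (const_mx 1) * chebyshev (multiplier g) d.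
Proof.
move=> gP; rewrite -pairing_chebyshev_kernel //.
rewrite -[X in X + _](real_character0 gP) -pairing_point -big_split.
by apply: eq_bigr => x _; rewrite /turan_witness mulrDr.
Qed.

Lemma multiplier_trivial g : (0 < n)%N -> (forall i, g (unitv i) = 1) ->
  multiplier g = 1 + 2 / n%:R.
Proof.
move=> n0 g1; rewrite /multiplier (eq_bigr (fun=> 1)) // sumr_const card_ord.
by rewrite mulrDr mulVf ?pnatr_eq0 -?lt0n // mulrC.
Qed.

(** If [g] is nontrivial on some unit vector, the Chebyshev term is at least -1 and the point mass
    at 0 compensates it. Otherwise the argument is [1 + 2 / n] and the growth bound applies. *)
Lemma turan_witness_positive g d : (0 < n)%N -> real_character g ->
  0 <= pairing g (turan_witness d).
Proof.
move=> n0 gP; rewrite pairing_turan_witness //.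
have [/existsP[i gi]|] := boolP [exists i, g (unitv i) != 1].
  have := chebyshev_le1 d (multiplier_le1 gP gi).
  rewrite -[leLHS]mul1r -(gP.2 (const_mx 1)) -normrM ler_norml => /andP[lb _].
  by rewrite -lerBlDl sub0r.
rewrite negb_exists => /forallP g1.
have {}g1 i : g (unitv i) = 1 by apply/eqP/negPn/g1.
rewrite multiplier_trivial // real_character_ones // mul1r.
have t0 : 0 <= 2 / n%:R :> R by rewrite divr_ge0.
rewrite addr_ge0 // (le_trans _ (chebyshev_growth d t0)) // addr_ge0 //.
by rewrite mulr_ge0 ?sqr_ge0.
Qed.

Lemma sum_turan_witness d : (0 < n)%N ->
  2 + d%:R ^+ 2 * (2 / n%:R) <= \sum_x turan_witness d x.
Proof.
move=> n0; rewrite -pairing1 pairing_turan_witness; last exact: real_character1.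
have t0 : 0 <= 2 / n%:R :> R by rewrite divr_ge0.
rewrite multiplier_trivial // mul1r.
by have := chebyshev_growth d t0; lra.
Qed.

Lemma turan_witness0 d : (d < n)%N -> turan_witness d 0 = 1.
Proof.
move=> dn; rewrite /turan_witness eqxx.
suff /eqP-> : chebyshev_kernel d 0 == 0 by rewrite addr0.
apply: contraTT dn => /chebyshev_kernel_support.
by rewrite bias0 -leqNgt -(ler_nat R); lra.
Qed.

(** * The standard set and the dual bound for [lambda_pm] *)

Definition antipodal_set d : {set G} :=
  [set x | (x == 0) || (bias x <= 2 * d%:R - n%:R)]%SET.

Lemma antipodal_set_standard d : standard (antipodal_set d).
Proof.
split; last by rewrite inE eqxx.
rewrite -[LHS]imset_id; apply: eq_imset => x; exact/esym/cube_oppr.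
Qed.

Lemma turan_witness_classS d : (d < n)%N ->
  classS (antipodal_set d) (turan_witness d).
Proof.
move=> dn; split; first by exists 0; rewrite turan_witness0 ?oner_eq0.
move=> x; rewrite inE negb_or -ltNge => /andP[/negPf x0 bx].
rewrite /turan_witness x0 add0r; apply/eqP; apply: contraTT bx.
by move/chebyshev_kernel_support; rewrite -leNgt.
Qed.

Lemma coordinate_real_character i :
  real_character (fun x : G => sign2 R (x 0 i)).
Proof. by split=> [x y|x]; rewrite ?mxE ?sign2D ?norm_sign2. Qed.

(** The function [bias] is the sum of the coordinate characters, so it pairs nonnegatively with [f].
    The constant [n - 2 d] places the sign change of the weight at the threshold defining
    [antipodal_set]. *)
Lemma classSpm_dual_bound d f :
  classSpm (antipodal_set d) f ->
  (forall g, real_character g -> 0 <= pairing g f) ->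
  (n%:R - 2 * d%:R) * \sum_x f x <= (2 * n%:R - 2 * d%:R) * f 0.
Proof.
move=> [_ fN fP] fp.
apply: (@le_trans _ _ (\sum_x (n%:R - 2 * d%:R + bias x) * f x)).
  under [leRHS]eq_bigr do rewrite mulrDl.
  rewrite big_split /= -mulr_sumr lerDl.
  under eq_bigr do rewrite mulr_suml.
  rewrite exchange_big sumr_ge0 // => i _.
  exact: fp (coordinate_real_character i).
rewrite (bigD1 0) //= bias0 -[leRHS]addr0 lerD //; first by lra.
apply: sumr_le0 => x x0.
have [xA|xA] := boolP (x \in antipodal_set d).
  rewrite mulr_le0_ge0 ?fP //; move: xA; rewrite inE (negPf x0) /=; lra.
rewrite mulr_ge0_le0 ?fN //; move: xA; rewrite inE (negPf x0) /= -ltNge; lra.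
Qed.

Lemma is_lambda_exists (A : {set G}) : 0 \in A -> exists l : R, is_lambda A l.
Proof.
(* Imposing both signs off [A] encodes vanishing there. *)
move=> A0; apply: (@ratios_minimum R n (~: A) (~: A)); first by rewrite inE A0.
move=> f; split=> [[f0 fA]|[f0 fP fN]].
  by split=> // x; rewrite inE => /fA->.
by split=> // x xA; apply/eqP; rewrite eq_le fP ?fN // inE.
Qed.

Lemma is_lambda_pm_exists (A : {set G}) :
  0 \in A -> exists l : R, is_lambda_pm A l.
Proof.
move=> A0; apply: (@ratios_minimum R n A (~: A)); first by rewrite inE A0.
move=> f; split=> -[f0].
  by move=> fN fP; split=> // x; rewrite inE => /fN.
by move=> fP fN; split=> // x xA; rewrite fN // inE.
Qed.

End Construction.

Theorem theorem1p6 (R : realType) (eps : R) (eps_gt0 : 0 < eps) :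
  exists N : nat, forall n : nat, (N <= n)%N ->
  exists A : {set 'rV['Z_2]_n},
    standard A /\
    exists l lpm : R,
      [/\ is_lambda A l, is_lambda_pm A lpm, l < eps & lpm > 2^-1 - eps].
Proof.
have [m m3 me] : exists2 m : nat, (3 <= m)%N & m%:R^-1 < eps.
  exists (Num.bound eps^-1 + 3)%N; first by rewrite leq_addl.
  rewrite invf_plt ?posrE ?ltr0n ?addn_gt0 ?orbT //.
  apply: lt_le_trans (archi_boundP (ltW _)) _; first by rewrite invr_gt0.
  by rewrite ler_nat leq_addr.
(* With [d = n %/ m], this threshold ensures [d >= m ^ 2], while [d / n <= 1 / m < eps]. *)
exists (m ^ 3)%N => n mn.
have m0 : (0 < m)%N by exact: leq_trans m3.
pose d := (n %/ m)%N.
have dm : (d * m <= n)%N by exact: leq_trunc_div.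
have md : (m ^ 2 <= d)%N by rewrite leq_divRL // -expnSr.
have nd : (n < d.+1 * m)%N by exact: ltn_ceil.
have d0 : (0 < d)%N by apply: leq_trans md; rewrite expn_gt0 m0.
(* From [n < (d + 1) m <= 2 d m] and [m ^ 2 <= d]. It turns the witness sum [2 + 2 d ^ 2 / n] into
   at least [2 + m]. *)
have nm : (n * m <= 2 * d ^ 2)%N.
  apply: (@leq_trans (2 * d * m * m)).
    by rewrite leq_mul2r; apply/orP; right; nia.
  by rewrite -mulnA mulnn -mulnA leq_mul2l /= expnS expn1 leq_mul2l md orbT.
have dn : (2 * d < n)%N by nia.
have n0 : (0 < n)%N by lia.
have dn' : (d < n)%N by lia.
have n0R : 0 < n%:R :> R by rewrite ltr0n.
have m0R : 0 < m%:R :> R by rewrite ltr0n.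
have A0 : 0 \in antipodal_set R n d by rewrite inE eqxx.
exists (antipodal_set R n d); split; first exact: antipodal_set_standard.
have [l lP] := is_lambda_exists R A0.
have [lpm lpmP] := is_lambda_pm_exists R A0.
exists l, lpm; split => //.
  pose w := @turan_witness R n d.
  have big : 2 + m%:R <= \sum_x w x :> R.
    apply: le_trans (sum_turan_witness R d n0).
    rewrite lerD2l mulrA ler_pdivlMr // -natrX -!natrM ler_nat mulnC.
    by rewrite [leqRHS]mulnC.
  have sum0 : 0 < \sum_x w x :> R.
    by apply: lt_le_trans big; rewrite addr_gt0.
  have /lP.2 : ratios (classS (antipodal_set R n d))
      (w 0 / \sum_x w x).
    apply/(ratiosP (@cube_addxx n)); exists w; split => //.
      exact: turan_witness_classS.
    by move=> g gP; exact: turan_witness_positive.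
  move/le_lt_trans; apply; apply: lt_trans me.
  rewrite [w 0]turan_witness0 // mul1r ltf_pV2 ?posrE //.
  by apply: lt_le_trans big; rewrite ltrDr.
have [/(ratiosP (@cube_addxx n))[f [fA fp sf ->]] _] := lpmP.
have key := classSpm_dual_bound fA fp.
have f0 : 0 <= f 0.
  exact: le_trans (normr_ge0 _) (positive_definite_bound 0 fp).
have dmR : d%:R / n%:R <= m%:R^-1 :> R.
  by rewrite ler_pdivrMr // ler_pdivlMl // -natrM ler_nat mulnC.
apply: (@lt_le_trans _ _ (2^-1 - d%:R / n%:R)); first by lra.
(* The dual bound has [2 n - 2 d] on the right; enlarging it to [2 n] is harmless since
   [f 0 >= 0]. *)
have -> : 2^-1 - d%:R / n%:R = (n%:R - 2 * d%:R) / (2 * n%:R) :> R.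
  by field; rewrite gt_eqF.
rewrite ler_pdivrMr ?mulr_gt0 // mulrAC ler_pdivlMr //.
apply: le_trans key _; rewrite mulrC ler_wpM2l //; have := ler0n R d; lra.
Qed.
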